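(* Let $\mathcal{M}=(E,\mathcal{I})$ be a loopless matroid with rank function $r$, rank $r(E)=\rho$, and girth $\gamma$ (in particular, $\mathcal{M}$ has at least one dependent set). Then $$\mathcal{CG}(r)\ \ge\ 1-\frac1e+\frac{e^{-\rho}}{\rho}\left(\sum_{i=0}^{\gamma-2}(\gamma-1-i)\left[\binom{\rho}{i}(e-1)^i-\frac{\rho^i}{i!}\right]\right)\ \ge\ 1-\frac1e .$$ Furthermore, the last inequality is strict whenever $\gamma>2$.
   Context: Matroids are on a finite ground set. The girth of a matroid is the smallest size of a dependent set (equivalently, of a circuit). A matroid is loopless if every singleton is independent. For $f\colon 2^E\to\mathbb{R}_+$ and $x\in[0,1]^E$, the multilinear extension is $F(x)=\sum_{S\subseteq E}f(S)\prod_{i\in S}x_i\prod_{i\notin S}(1-x_i)$, and the concave extension is $\hat f(x)=\max\{\sum_{S\subseteq E}\lambda_S f(S): \sum_{S\ni i}\lambda_S=x_i\ \forall i\in E,\ \sum_{S\subseteq E}\lambda_S=1,\ \lambda\ge0\}$. The correlation gap of $f$ is $\mathcal{CG}(f)=\inf_{x\in[0,1]^E}F(x)/\hat f(x)$, with the convention $0/0=1$. *)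

(* Defs.v *)
From mathcomp Require Import all_boot all_order all_algebra.
From mathcomp Require Import all_classical all_reals all_analysis.

Set Implicit Arguments.
Unset Strict Implicit.
Unset Printing Implicit Defensive.

Import Order.TTheory GRing.Theory Num.Theory.
Import numFieldNormedType.Exports.

Local Open Scope ring_scope.

Record matroid (E : finType) := Matroid {
  indep : pred {set E};
  indep_set0 : indep finset.set0;
  indep_subset : forall A B : {set E}, A \subset B -> indep B -> indep A;
  indep_augment : forall A B : {set E}, indep A -> indep B -> (#|A| < #|B|)%N ->
    exists2 b : E, b \in B :\: A & indep (b |: A)
}.

Definition rank (E : finType) (M : matroid E) (S : {set E}) : nat :=
  \max_(I : {set E} | (I \subset S) && indep M I) #|I|.

Definition loopless (E : finType) (M : matroid E) : Prop :=
  forall i : E, indep M [set i]%SET.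

(* A relation rather than a function: a matroid without dependent sets has no
   girth, so [has_girth M g] entails that a dependent set exists. *)
Definition has_girth (E : finType) (M : matroid E) (g : nat) : Prop :=
  (exists2 C : {set E}, ~~ indep M C & #|C| = g) /\
  (forall C : {set E}, ~~ indep M C -> (g <= #|C|)%N).

Section correlation_gap.
Context {R : realType} {E : finType}.
Implicit Types (f : {set E} -> R) (x : E -> R).

Definition multilinear_ext f x : R :=
  \sum_(S : {set E})
    f S * (\prod_(i | i \in S) x i) * (\prod_(i | i \notin S) (1 - x i)).

Definition concave_feasible x (lam : {set E} -> R) : Prop :=
  [/\ forall i : E, \sum_(S : {set E} | i \in S) lam S = x i,
      \sum_(S : {set E}) lam S = 1
    & forall S : {set E}, 0 <= lam S].

(* For x in [0,1]^E the feasible weights form a nonempty compact polytope, on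
   which the objective is linear; the supremum is therefore a maximum. *)
Definition concave_ext f x : R :=
  sup [set v : R | exists2 lam : {set E} -> R,
        concave_feasible x lam & v = \sum_(S : {set E}) lam S * f S]%classic.

(* The quotient a / b with the convention 0 / 0 = 1. *)
Definition ratio01 (a b : R) : R :=
  if (a == 0) && (b == 0) then 1 else a / b.

(* Meant for nonnegative f: the ratios are then bounded below by 0, so [inf] is
   the genuine infimum; moreover a vanishing concave extension forces a
   vanishing multilinear extension, so that 0 / 0 is the only division by 0. *)
Definition correlation_gap f : R :=
  inf [set v : R | exists2 x : E -> R,
        (forall i : E, 0 <= x i <= 1)
        & v = ratio01 (multilinear_ext f x) (concave_ext f x)]%classic.

End correlation_gap.

(* Main.v *)
Require Import Defs.
From mathcomp Require Import all_boot all_order all_algebra.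
From mathcomp Require Import all_classical all_reals all_analysis.
From mathcomp Require Import ring lra zify.

(** Write k = gamma - 1, so that every set of at most k elements is
    independent, and let F be the multilinear extension of the rank function.

    Reduction to tight points. Replacing every set in a convex decomposition
    of x by one of its bases gives a point y <= x of the independence polytope
    whose coordinate sum is the value of the decomposition. As F is monotone,
    it suffices to show b * y(E) <= F(y) on the polytope, where b is the
    claimed bound. Both sides are affine in each coordinate, so an element that
    is in no tight set can be moved, either down to 0 or up until a tight set
    contains it ([ler_multilinear_tight]). Tight sets are closed under union,
    hence y may be taken to live on a tight set, and y(E) = n is a rank.

    A tight point with n >= k. Split r(S) into min(|S|, k) and the excess of
    r(S) over k.
    - The random size is a sum of Bernoulli variables. Since l |-> (k - l)^+ is
      convex, replacing them one by one by Poisson variables of the same means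
      increases E(k - |S|)^+ ([poisson_replacement]).
    - The excess is monotone, so one may sample each i with the smaller
      probability 1 - exp(- y_i), that is, run independent exponential clocks
      of rates y_i up to time 1. In state S the rank goes up at rate at least
      n - r(S), exactly the rate of n independent clocks of rate 1 of which
      r(S) have rung. Hence the rank at time 1 stochastically dominates a
      Binomial(n, 1 - 1/e) variable ([clock_rank_lt_le]).
    Together, F(y) >= n (1 - 1/e) + exp(- n) [gap n k], where
    exp(- n) [gap n k] is E(k - Bin(n, 1 - 1/e))^+ - E(k - Poi(n))^+
    ([multilinear_rank_ge]).

    Comparison of ranks. It remains to see that exp(- n) [gap n k] / n is
    nonincreasing in n. With [shortfall] for E(k - .)^+, the expression
    (n + 1) f_n - n f_(n+1) equals k P(Bin(n + 1) <= k) when f is the binomial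
    shortfall and is at most that when f is the Poisson one
    ([shortfall_binl_step], [shortfall_pois_step]). Both follow by induction on
    n, adding one summand to the binomial and one unit of mean to the Poisson
    variable. For n = k the bound is at most 1, which settles the tight points
    with n < k, where F(y) = n.

    Finally the gap is nonnegative because Bin(n, 1 - 1/e) is the number of
    nonzero terms among n independent Poisson variables of mean 1, and it is
    positive for k >= 2 already through the event that at most one of them is
    nonzero, as e > 2. *)

Set Implicit Arguments.
Unset Strict Implicit.
Unset Printing Implicit Defensive.

Import Order.TTheory GRing.Theory Num.Theory.
Import numFieldNormedType.Exports.

Local Open Scope ring_scope.

(** * Differential inequalities *)

Section Calculus.
Context {R : realType}.
Implicit Types f df : R -> R.

Lemma is_derive_bigsum (I : Type) (r : seq I) (P : pred I)
    (f : I -> R -> R) (df : I -> R) (t : R) :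
  (forall i, is_derive t 1 (f i) (df i)) ->
  is_derive t 1 (fun s => \sum_(i <- r | P i) f i s)
    (\sum_(i <- r | P i) df i).
Proof.
move=> fd; elim: r => [|i r IH].
  rewrite big_nil; rewrite (_ : (fun s => _) = cst 0); first exact: is_derive_cst.
  by apply/funext => s; rewrite big_nil.
rewrite big_cons.
rewrite (_ : (fun s => _) = fun s =>
  if P i then f i s + \sum_(j <- r | P j) f j s else \sum_(j <- r | P j) f j s).
  by case: (P i) => //; exact: is_deriveD.
by apply/funext => s; rewrite big_cons.
Qed.

Lemma derive_ge0_le f df (a b : R) : a <= b ->
  (forall t : R, is_derive t 1 f (df t)) -> (forall t : R, a <= t -> 0 <= df t) ->
  f a <= f b.
Proof.
move=> ab fd df0.
have der (t : R) : derivable f t 1 by case: (fd t).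
have der1 (t : R) : derive1 f t = df t by rewrite derive1E; case: (fd t).
apply: (@ger0_derive1_le_cc _ f a b) => //.
- by move=> t; rewrite in_itv/= => /andP[/ltW at_ _]; rewrite der1 df0.
- apply: derivable_within_continuous => t _; exact: der.
- by rewrite in_itv/= lexx.
- by rewrite in_itv/= ab lexx.
Qed.

(** Multiplying f by exp (- a t) absorbs the linear term: the product has a
    nonnegative derivative. *)
Lemma gronwall_ge0 f df (a b : R) : 0 <= b ->
  (forall t : R, is_derive t 1 f (df t)) -> 0 <= f 0 ->
  (forall t : R, 0 <= t -> a * f t <= df t) -> 0 <= f b.
Proof.
move=> b0 fd f0 dfge.
pose g t := expR (- (a * t)) * f t.
have gd (t : R) : is_derive t 1 g (expR (- (a * t)) * (df t - a * f t)).
  have ad : is_derive t (1 : R) (fun s : R => - (a * s)) (- a).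
    by apply: is_derive_eq; rewrite /GRing.scale /=; ring.
  have ed := @is_derive1_comp _ expR _ t _ _ (is_derive_expR (- (a * t))) ad.
  refine (@is_derive_eq _ _ _ _ _ _ _ _ (is_deriveM ed (fd t)) _).
  by rewrite /GRing.scale /=; ring.
have := derive_ge0_le b0 gd; rewrite /g mulr0 oppr0 expR0 mul1r => gle.
rewrite -(@pmulr_rge0 _ (expR (- (a * b)))) ?expR_gt0//.
apply: le_trans f0 (gle _) => t t0.
by rewrite mulr_ge0 ?expR_ge0// subr_ge0 dfge.
Qed.

End Calculus.

(** * Binomial and Poisson distribution functions *)

Section PoissonBinomial.
Context {R : realType}.
Implicit Types (x y u : R) (a b f : nat -> R).

(** exp (- x) times this is the probability that a Poisson(x) variable is less
    than c; leaving the factor out keeps all recurrences polynomial. *)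
Definition pois x (c : nat) : R := \sum_(0 <= i < c) x ^+ i / (i`!)%:R.

(** When u = p / (1 - p), this is (1 + u) ^ n times the probability that a
    Binomial(n, p) variable is less than c. It is used with u = e - 1, that is
    p = 1 - 1/e, where (1 + u) ^ n = e ^ n is also the Poisson(n) factor. *)
Definition binl u (n c : nat) : R := \sum_(0 <= i < c) 'C(n, i)%:R * u ^+ i.

(** For a distribution function a c = P(X < c), this is E(k - X)^+, written as
    the sum of P(X <= c) over c < k. *)
Definition shortfall a (k : nat) : R := \sum_(0 <= c < k) a c.+1.

Lemma shortfall0 a : shortfall a 0 = 0.
Proof. by rewrite /shortfall big_nil. Qed.

Lemma shortfallS a k : shortfall a k.+1 = shortfall a k + a k.+1.
Proof. by rewrite /shortfall big_nat_recr. Qed.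

Lemma poisS x c : pois x c.+1 = pois x c + x ^+ c / (c`!)%:R.
Proof. by rewrite /pois big_nat_recr. Qed.

Lemma pois0 x : pois x 0 = 0.
Proof. by rewrite /pois big_nil. Qed.

Lemma pois_0 c : pois 0 c.+1 = 1.
Proof.
elim: c => [|c IH]; first by rewrite poisS pois0 expr0 fact0 add0r divr1.
by rewrite poisS IH expr0n mul0r addr0.
Qed.

Lemma pois_term_ge0 x i : 0 <= x -> 0 <= x ^+ i / (i`!)%:R :> R.
Proof. by move=> x0; rewrite divr_ge0 ?exprn_ge0. Qed.

Lemma pois_ge0 x c : 0 <= x -> 0 <= pois x c.
Proof. by move=> x0; apply: sumr_ge0 => i _; apply: pois_term_ge0. Qed.

Lemma binl0 u n : binl u n 0 = 0.
Proof. by rewrite /binl big_nil. Qed.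

Lemma binlS u n c : binl u n c.+1 = binl u n c + 'C(n, c)%:R * u ^+ c.
Proof. by rewrite /binl big_nat_recr. Qed.

Lemma binl_0 u c : binl u 0 c.+1 = 1.
Proof.
elim: c => [|c IH]; first by rewrite binlS binl0 bin0 expr0 add0r mulr1.
by rewrite binlS IH bin0n mul0r addr0.
Qed.

(** Condition on the last of the n + 1 trials. *)
Lemma binl_rec u n c : binl u n.+1 c.+1 = binl u n c.+1 + u * binl u n c.
Proof.
elim: c => [|c IH].
  by rewrite !binlS !binl0 !bin0 !expr0 mulr0 addr0.
by rewrite binlS IH binS natrD (binlS _ n c.+1) (binlS _ n c) exprS; ring.
Qed.

Lemma binl_le u n c d : 0 <= u -> (c <= d)%N -> binl u n c <= binl u n d.
Proof.
move=> u0; elim: d => [|d IH]; first by rewrite leqn0 => /eqP ->.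
rewrite leq_eqVlt => /predU1P[->//|]; rewrite ltnS => /IH /le_trans; apply.
by rewrite binlS lerDl mulr_ge0 ?exprn_ge0.
Qed.

Lemma binl_total u n c : (n < c)%N -> binl u n c = (1 + u) ^+ n.
Proof.
elim: n c => [|n IH] [|c]//; first by rewrite binl_0 expr0.
by rewrite ltnS => nc; rewrite binl_rec (IH c.+1 (leqW nc)) (IH _ nc) exprS; ring.
Qed.

Lemma shortfall_binl_rec u n k :
  shortfall (binl u n.+1) k.+1
    = shortfall (binl u n) k.+1 + u * shortfall (binl u n) k.
Proof.
elim: k => [|k IH]; first by rewrite !shortfallS !shortfall0 binl_rec binl0; ring.
by rewrite shortfallS IH binl_rec (shortfallS _ k.+1) (shortfallS _ k); ring.
Qed.

(** In probabilistic terms with p = u / (1 + u):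
    (n + 1) E(k - Bin(n))^+ - n E(k - Bin(n + 1))^+ = k P(Bin(n + 1) <= k).
    Conditioning on one more trial turns the identity for n into the one for
    n + 1, up to a difference of consecutive shortfalls. *)
Lemma shortfall_binl_step u n k :
  n.+1%:R * (1 + u) * shortfall (binl u n) k - n%:R * shortfall (binl u n.+1) k
    = k%:R * binl u n.+1 k.+1.
Proof.
elim: n k => [|n IH] k.
  rewrite mul0r subr0 mul1r.
  have -> : shortfall (binl u 0) k = k%:R.
    by elim: k => [|k IH]; rewrite ?shortfall0// shortfallS IH binl_0 -natr1.
  case: k => [|k]; first by rewrite mulr0 mul0r.
  by rewrite binl_total// expr1 mulrC.
case: k => [|k]; first by rewrite !shortfall0 !mulr0 mul0r subrr.
have IH1 := IH k.+1; have IH0 := IH k; clear IH.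
have rec1 := shortfall_binl_rec u n.+1 k.
have rec0 := shortfall_binl_rec u n k.
have last1 := shortfallS (binl u n.+1) k.
rewrite (binl_rec u n.+1) rec1.
have -> : k.+1%:R * (binl u n.+1 k.+2 + u * binl u n.+1 k.+1)
    = k.+1%:R * binl u n.+1 k.+2 + u * (k%:R * binl u n.+1 k.+1)
      + u * binl u n.+1 k.+1 by rewrite -natr1; ring.
rewrite -IH1 -IH0.
have -> : binl u n.+1 k.+1
    = shortfall (binl u n.+1) k.+1 - shortfall (binl u n.+1) k.
  by rewrite last1; ring.
rewrite rec0 -!natr1; ring.
Qed.

Lemma sum_convolution f a b k :
  (forall s, b s = \sum_(0 <= j < s.+1) f j * a (s - j)%N) ->
  \sum_(0 <= s < k) b s
    = \sum_(0 <= j < k) f j * \sum_(0 <= s < (k - j)%N) a s.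
Proof.
move=> bE; elim: k => [|k IH]; first by rewrite !big_nil.
rewrite big_nat_recr//= IH bE !big_nat_recr//= subSnn subnn big_nat1 addrA.
congr (_ + _); rewrite -big_split/=; apply: eq_big_nat => j /andP[_ jk].
by rewrite subSn 1?ltnW// big_nat_recr//= mulrDr.
Qed.

(** A Poisson variable of mean x + y is a sum of two independent ones; the
    coefficients are those of the binomial formula. *)
Lemma pois_add x y c :
  pois (x + y) c
    = \sum_(0 <= j < c) y ^+ j / (j`!)%:R * pois x (c - j).
Proof.
apply: sum_convolution => s.
rewrite exprDn mulr_suml big_mkord; apply: eq_bigr => -[j /= js] _.
rewrite ltnS in js; rewrite -mulr_natr -(bin_fact js) !natrM.
have pos m : (m`!)%:R != 0 :> R by rewrite pnatr_eq0 -lt0n fact_gt0.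
field; rewrite !pos/= pnatr_eq0 -lt0n bin_gt0//.
Qed.

Lemma shortfall_pois_add x y k :
  shortfall (pois (x + y)) k
    = \sum_(0 <= j < k) y ^+ j / (j`!)%:R * shortfall (pois x) (k - j).
Proof.
apply: (sum_convolution (a := fun s => pois x s.+1)) => s.
rewrite pois_add; apply: eq_big_nat => j /andP[_ js].
by rewrite subSn.
Qed.

Lemma is_derive_pois c x : is_derive x 1 (pois ^~ c.+1) (pois x c).
Proof.
elim: c => [|c IH].
  rewrite pois0 (_ : pois ^~ 1%N = cst 1); first exact: is_derive_cst.
  by apply/funext => y; rewrite poisS pois0 expr0 fact0 add0r divr1.
rewrite (_ : pois ^~ c.+2 =
    pois ^~ c.+1 + (c.+1`!)%:R^-1 \*: (id ^+ c.+1)); last first.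
  by apply/funext => y; rewrite poisS fctE/= exprfctE mulrC.
have Xd := is_deriveZ (c.+1`!)%:R^-1 (is_deriveX c.+1 (is_derive_id x 1)).
refine (@is_derive_eq _ _ _ _ _ _ _ _ (is_deriveD IH Xd) _).
rewrite poisS /GRing.scale/= factS natrM mulr1.
have pos m : (m`!)%:R != 0 :> R by rewrite pnatr_eq0 -lt0n fact_gt0.
by rewrite -mulr_natl; field; rewrite pos -?nat1r ?nat1r ?natr1 pnatr_eq0.
Qed.

(** No boundary term appears because pois x 0 = 0: differentiating shifts the
    index of the summed distribution functions down by one. *)
Lemma is_derive_shortfall_pois c x :
  is_derive x 1 (fun y => shortfall (pois y) c.+1) (shortfall (pois x) c).
Proof.
have := is_derive_bigsum (index_iota 0 c.+1) predT (is_derive_pois ^~ x).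
by rewrite big_nat_recl// pois0 add0r.
Qed.

Lemma is_derive_expRN x : is_derive x 1 (fun y => expR (- y)) (- expR (- x)).
Proof.
have Nd := is_deriveNid x 1.
refine (@is_derive_eq _ _ _ _ _ _ _ _
  (@is_derive1_comp _ expR _ x _ _ (is_derive_expR (- x)) Nd) _).
by rewrite /GRing.scale/= mulrN1.
Qed.

Lemma pois_cdf_le x y c : 0 <= x -> x <= y ->
  expR (- y) * pois y c <= expR (- x) * pois x c.
Proof.
move=> x0 xy; case: c => [|c]; first by rewrite !pois0 !mulr0.
pose f (z : R) := - (expR (- z) * pois z c.+1).
pose df (z : R) := expR (- z) * (z ^+ c / (c`!)%:R).
have fd (z : R) : is_derive z 1 f (df z).
  have H := is_deriveN (is_deriveM (is_derive_expRN z) (is_derive_pois c z)).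
  refine (@is_derive_eq _ _ _ _ _ _ _ _ H _).
  by rewrite /GRing.scale/= /df poisS; ring.
rewrite -lerN2; apply: (derive_ge0_le xy fd) => z xz.
by rewrite mulr_ge0 ?expR_ge0// pois_term_ge0// (le_trans x0).
Qed.

Lemma pois_le_expR x c : 0 <= x -> pois x c <= expR x.
Proof.
move=> x0; case: c => [|c]; first by rewrite pois0 expR_ge0.
have := pois_cdf_le c.+1 (lexx 0) x0.
by rewrite oppr0 expR0 mul1r pois_0 expRN mulrC ler_pdivrMr ?expR_gt0// mul1r.
Qed.

(** The right side is a convex function of y, its derivative being minus a
    Poisson distribution function, which decreases in the mean. The left side is
    its tangent at y = 0; it is also the expectation obtained by adding a
    Bernoulli(y) variable in place of a Poisson(y) one. *)
Lemma shortfall_pois_tangent x y c : 0 <= x -> 0 <= y ->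
  expR (- x) * ((1 - y) * shortfall (pois x) c.+1 + y * shortfall (pois x) c)
    <= expR (- (x + y)) * shortfall (pois (x + y)) c.+1.
Proof.
move=> x0 y0; pose V (z : R) := expR (- z) * pois z c.+1.
pose f (z : R) := expR (- z) * shortfall (pois z) c.+1 + z *: V x.
have xy : x <= x + y by rewrite lerDl.
have fd (z : R) : is_derive z 1 f (V x - V z).
  have := is_deriveD
    (is_deriveM (is_derive_expRN z) (is_derive_shortfall_pois c z))
    (is_deriveM (is_derive_id z 1) (is_derive_cst (V x) z 1)).
  move=> H; refine (@is_derive_eq _ _ _ _ _ _ _ _ H _).
  by rewrite /GRing.scale/= /V shortfallS /cst; ring.
have df0 (z : R) : x <= z -> 0 <= V x - V z.
  by move=> xz; rewrite subr_ge0 pois_cdf_le.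
have := derive_ge0_le xy fd df0; rewrite /f /V /GRing.scale/= !shortfallS.
set A := expR (- (x + y)); set B := expR (- x).
set C := pois (x + y) c.+1; set D := pois x c.+1.
set F := shortfall (pois (x + y)) c; set G := shortfall (pois x) c.
move=> h.
have -> : B * ((1 - y) * (G + D) + y * G) =
  (B * (G + D) + x * (B * D)) - (x + y) * (B * D) by ring.
by rewrite lerBlDr.
Qed.

Lemma shortfall_cat a k n : (k <= n)%N ->
  shortfall a n = shortfall a k + \sum_(k <= c < n) a c.+1.
Proof. by move=> kn; apply: big_cat_nat. Qed.

Lemma sum_shortfall_cumulative (w : nat -> R) k :
  \sum_(0 <= i < k) (k%:R - i%:R) * w i
    = shortfall (fun c => \sum_(0 <= i < c) w i) k.
Proof.
elim: k => [|k IH]; first by rewrite shortfall0 big_nil.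
rewrite shortfallS -IH !big_nat_recr//= addrA -big_split/= -natr1.
rewrite (addrC k%:R) addrK mul1r; congr (_ + _).
by apply: eq_bigr => i _; ring.
Qed.

(** This is the evolution equation of the number of rung clocks among n
    independent clocks of rate 1: from state c there are n - c clocks left.
    The factor exp (n t) hidden in [binl] accounts for the sign of the first
    coefficient. *)
Lemma is_derive_binl n c (t : R) : (c <= n)%N ->
  is_derive t 1 (fun s => binl (expR s - 1) n c.+1)
    (c%:R * binl (expR t - 1) n c.+1 + (n - c)%:R * binl (expR t - 1) n c).
Proof.
pose u (s : R) := expR s - 1.
have ud : is_derive t 1 u (expR t).
  have := is_deriveB (is_derive_expR t) (is_derive_cst (1 : R) t 1).
  by rewrite subr0.
elim: c => [|c IH] cn.
  rewrite mul0r add0r binl0 mulr0 (_ : (fun s => _) = cst 1).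
    exact: is_derive_cst.
  by apply/funext => s; rewrite binlS binl0 bin0 expr0 mulr1 add0r.
have Xd := is_deriveZ ('C(n, c.+1)%:R : R) (is_deriveX c.+1 ud).
rewrite (_ : (fun s => _) =
  (fun s => binl (expR s - 1) n c.+1) + 'C(n, c.+1)%:R \*: (u ^+ c.+1)); last first.
  by apply/funext => s; rewrite binlS fctE/= exprfctE.
refine (@is_derive_eq _ _ _ _ _ _ _ _ (is_deriveD (IH (ltnW cn)) Xd) _).
rewrite /GRing.scale/= -/(u t).
have eE : expR t = 1 + u t by rewrite /u addrCA subrr addr0.
have := mul_bin_left n c => /(congr1 (fun m => m%:R : R)); rewrite !natrM => h.
rewrite !binlS eE (natrB _ cn) exprS.
have nc : (n - c)%:R = n%:R - c%:R :> R by rewrite natrB// ltnW.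
rewrite nc in h *; rewrite -!natr1 in h *.
set w := u t ^+ c; set b := binl _ _ _; set B := 'C(n, c)%:R in h *.
set B1 := 'C(n, c.+1)%:R in h *.
have -> : B1 * ((c%:R + 1) * w * (1 + u t)) = ((c%:R + 1) * B1) * w * (1 + u t) by ring.
have -> : (c%:R + 1) * (b + B * w + B1 * (u t * w))
   = (c%:R + 1) * (b + B * w) + ((c%:R + 1) * B1) * (u t * w) by ring.
rewrite h; ring.
Qed.

End PoissonBinomial.

(** * The gap between binomial and Poisson shortfalls *)

Section GapMonotonicity.
Context {R : realType}.
Implicit Types (x : R) (n k c : nat).

Notation e := (expR 1 : R).

Lemma pois_le x c d : 0 <= x -> (c <= d)%N -> pois x c <= pois x d.
Proof.
move=> x0; elim: d => [|d IH]; first by rewrite leqn0 => /eqP ->.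
rewrite leq_eqVlt => /predU1P[->//|]; rewrite ltnS => /IH /le_trans; apply.
by rewrite poisS lerDl pois_term_ge0.
Qed.

Lemma pois_term1 j : 1 ^+ j / (j`!)%:R = (j`!)%:R^-1 :> R.
Proof. by rewrite expr1n mul1r. Qed.

Lemma pois1S c : pois 1 c.+1 = 1 + \sum_(0 <= j < c) (j.+1`!)%:R^-1 :> R.
Proof.
rewrite /pois big_nat_recl// pois_term1 fact0 invr1; congr (_ + _).
by apply: eq_bigr => j _; rewrite pois_term1.
Qed.

Lemma e_gt2 : 2 < e.
Proof.
apply: lt_le_trans (pois_le_expR 3 ler01).
by rewrite !poisS pois0 !pois_term1 !factS fact0/= !muln1; lra.
Qed.

Lemma e1_ge0 : 0 <= e - 1.
Proof. by have := e_gt2; lra. Qed.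

(** A Poisson(n) variable is a sum of n independent Poisson(1) variables, and
    the number of nonzero ones among them is Binomial(n, 1 - 1/e). In the
    induction, a nonzero new term lowers the threshold by at least one. *)
Lemma pois_le_binl n c : pois n%:R c <= binl (e - 1) n c.
Proof.
elim: n c => [|n IH] [|c]; rewrite ?pois0 ?binl0//; first by rewrite pois_0 binl_0.
rewrite binl_rec -natr1 pois_add big_nat_recl// subn0 pois_term1 fact0 invr1 mul1r.
apply: lerD (IH _) _.
apply: le_trans (ler_wpM2l e1_ge0 (IH c)).
have -> : \sum_(0 <= j < c) 1 ^+ j.+1 / (j.+1`!)%:R * pois n%:R (c.+1 - j.+1)
   = \sum_(0 <= j < c) (j.+1`!)%:R^-1 * pois n%:R (c - j) :> R.
  by apply: eq_bigr => j _; rewrite pois_term1 subSS.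
apply: (@le_trans _ _ (\sum_(0 <= j < c) (j.+1`!)%:R^-1 * pois n%:R c)).
  apply: ler_sum => j _; rewrite ler_wpM2l ?invr_ge0//.
  by apply: pois_le => //; rewrite leq_subr.
rewrite -mulr_suml ler_wpM2r ?pois_ge0//.
by rewrite lerBrDl -pois1S pois_le_expR.
Qed.

(** Lowering k by j removes j of the summed distribution functions, each at
    most the one at k. *)
Lemma shortfall_pois_drop n k j : (j <= k)%N ->
  shortfall (pois n%:R) k - shortfall (pois n%:R) (k - j)
    <= j%:R * binl (e - 1) n k.
Proof.
elim: j => [|j IH] jk; first by rewrite subn0 subrr mul0r.
have kj : (k - j = (k - j.+1).+1)%N by lia.
have := IH (ltnW jk); rewrite kj shortfallS -kj.
have : pois n%:R (k - j) <= binl (e - 1) n k.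
  apply: le_trans (pois_le_binl _ _) _.
  by apply: binl_le; rewrite ?e1_ge0// leq_subr.
by rewrite -natr1; lra.
Qed.

(** The Poisson counterpart of [shortfall_binl_step], as an inequality. Let N_c
    be n + 1 independent Poisson(1) variables with sum N. Pointwise,
    sum_c (k - N + N_c)^+ - n (k - N)^+ is 0 when more than k of the N_c are
    nonzero and is at most k otherwise; taking expectations gives the claim. The
    induction on n runs this argument one variable at a time. *)
Lemma shortfall_pois_step n k :
  n.+1%:R * e * shortfall (pois n%:R) k - n%:R * shortfall (pois n.+1%:R) k
    <= k%:R * binl (e - 1) n.+1 k.+1.
Proof.
elim: n k => [|n IH] k.
  rewrite mul0r subr0 mul1r.
  have -> : shortfall (pois 0) k = k%:R :> R.
    by elim: k => [|k IH]; rewrite ?shortfall0// shortfallS IH pois_0 -natr1.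
  case: k => [|k]; first by rewrite mulr0 mul0r.
  by rewrite binl_total// expr1 mulrC addrCA subrr addr0.
case: k => [|k]; first by rewrite !shortfall0 !mulr0 mul0r subrr.
set psi := shortfall (pois n.+1%:R) k.+1.
set U := binl (e - 1) n.+1 k.+1.
have psi_le : psi <= k.+1%:R * U.
  have := shortfall_pois_drop n.+1 (leqnn k.+1).
  by rewrite subnn shortfall0 subr0.
pose f (j : nat) : R := (j`!)%:R^-1.
pose t j := n.+1%:R * e * shortfall (pois n%:R) (k.+1 - j)
  - n%:R * shortfall (pois n.+1%:R) (k.+1 - j)
  - shortfall (pois n.+1%:R) (k.+1 - j).
have conv (m : nat) : shortfall (pois m.+1%:R) k.+1
    = \sum_(0 <= j < k.+1) f j * shortfall (pois m%:R) (k.+1 - j) :> R.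
  rewrite -natr1 shortfall_pois_add; apply: eq_bigr => j _.
  by rewrite pois_term1.
have -> : n.+2%:R * e * psi - n.+1%:R * shortfall (pois n.+2%:R) k.+1
    = \sum_(0 <= j < k.+1) f j * t j + e * psi.
  have -> : n.+2%:R * e * psi = n.+1%:R * e * psi + e * psi.
    by rewrite -(natr1 n.+1); ring.
  rewrite addrAC; congr (_ + _).
  rewrite conv {1}/psi conv !mulr_sumr -sumrB; apply: eq_bigr => j _.
  by rewrite /t -natr1; ring.
(* t j is the contribution of the value j of the added Poisson(1) variable;
   only j = 0 leaves the threshold of the binomial bound at k + 2. *)
have t0 : t 0%N <= k.+1%:R * binl (e - 1) n.+1 k.+2 - psi.
  by rewrite /t subn0 lerD2r IH.
have tS j : (j < k)%N -> t j.+1 <= k.+1%:R * U - psi.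
  move=> jk; have jk1 : (j.+1 <= k.+1)%N by rewrite ltnW.
  have d := shortfall_pois_drop n.+1 jk1.
  have i := IH (k.+1 - j.+1)%N.
  have b : (k.+1 - j.+1)%:R * binl (e - 1) n.+1 (k.+1 - j.+1).+1
      <= (k.+1 - j.+1)%:R * U.
    by rewrite ler_wpM2l// binl_le ?e1_ge0//; lia.
  have kE : k.+1%:R * U = (k.+1 - j.+1)%:R * U + j.+1%:R * U.
    by rewrite -mulrDl -natrD subnK.
  by rewrite /t kE /psi; move: d i b; rewrite -/U; lra.
have sum_le : \sum_(0 <= j < k.+1) f j * t j
    <= k.+1%:R * binl (e - 1) n.+1 k.+2 - psi
       + (pois 1 k.+1 - 1) * (k.+1%:R * U - psi).
  rewrite big_nat_recl// /f fact0 invr1 mul1r lerD//.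
  rewrite pois1S addrAC subrr add0r mulr_suml.
  by apply: ler_sum_nat => j /andP[_ jk]; rewrite ler_wpM2l ?invr_ge0// tS.
have p1 := pois_le_expR k.+1 (@ler01 R).
rewrite (binl_rec _ n.+1) mulrDr.
apply: le_trans (lerD sum_le (lexx _)) _.
have : (e - pois 1 k.+1) * psi <= (e - pois 1 k.+1) * (k.+1%:R * U).
  by rewrite ler_wpM2l// subr_ge0.
by rewrite -/U; nra.
Qed.

(** exp (- n) times this is E(k - Bin(n, 1 - 1/e))^+ - E(k - Poi(n))^+. *)
Definition gap n k : R := shortfall (binl (e - 1) n) k - shortfall (pois n%:R) k.

Lemma gap_ge0 n k : 0 <= gap n k.
Proof.
by rewrite /gap subr_ge0; apply: ler_sum => c _; apply: pois_le_binl.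
Qed.

(** All terms are nonnegative, so the one at threshold 2 suffices:
    1 + n (e - 1) > 1 + n. *)
Lemma gap_gt0 n k : (0 < n)%N -> (1 < k)%N -> 0 < gap n k.
Proof.
case: k => [|[|k]]// n0 _; elim: k => [|k IH]; last first.
  rewrite /gap 2!(shortfallS _ k.+2).
  have := pois_le_binl n k.+3; move: IH; rewrite /gap; lra.
rewrite /gap !shortfallS !shortfall0 !binlS !poisS binl0 pois0 bin0 bin1.
rewrite !expr0 !expr1 !fact0 (factS 0) fact0 muln1 !divr1.
have : 0 < n%:R * (e - 2) by rewrite mulr_gt0 ?ltr0n// subr_gt0 e_gt2.
by nra.
Qed.

Lemma gap_step n k : n%:R * gap n.+1 k <= n.+1%:R * e * gap n k.
Proof.
have := shortfall_pois_step n k; have := shortfall_binl_step (e - 1) n k.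
by rewrite /gap (addrC 1) subrK => <-; lra.
Qed.

Lemma gap_ratio_le m n k : (0 < m)%N -> (m <= n)%N ->
  expR (- n%:R) / n%:R * gap n k <= expR (- m%:R) / m%:R * gap m k.
Proof.
move=> m0; elim: n => [|n IH]; first by rewrite leqNgt m0.
rewrite leq_eqVlt => /predU1P[->//|]; rewrite ltnS => mn.
apply: le_trans (IH mn).
have n0 : n%:R != 0 :> R by rewrite pnatr_eq0; lia.
have -> : expR (- n.+1%:R) / n.+1%:R * gap n.+1 k
    = expR (- n.+1%:R) / (n%:R * n.+1%:R) * (n%:R * gap n.+1 k).
  by field; rewrite n0 nat1r pnatr_eq0.
apply: le_trans (ler_wpM2l _ (gap_step n k)) _.
  by rewrite divr_ge0 ?mulr_ge0// expR_ge0.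
rewrite le_eqVlt; apply/orP; left; apply/eqP; rewrite -natr1 opprD expRD (expRN 1).
have n10 : n%:R + 1 != 0 :> R by rewrite natr1 pnatr_eq0.
by field; rewrite n0 n10 gt_eqF ?expR_gt0.
Qed.

(** The expected number of failures in n trials with success probability
    1 - 1/e. *)
Lemma shortfall_binl_diag n :
  expR (- n%:R) * shortfall (binl (e - 1) n) n = n%:R / e.
Proof.
have expRNn m : expR (- m%:R) = e ^- m by rewrite expRN -[m%:R]mulr1 expRM_natl.
have e0 : e != 0 by rewrite gt_eqF ?expR_gt0.
rewrite expRNn; elim: n => [|n IH]; first by rewrite shortfall0 mulr0 mul0r.
rewrite shortfall_binl_rec shortfallS binl_total// subrKC exprS.
have -> : shortfall (binl (e - 1) n) n = n%:R / e * e ^+ n.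
  by rewrite -IH mulrAC mulVf ?mul1r// expf_neq0.
by rewrite -natr1; field; rewrite e0 expf_neq0.
Qed.

Lemma gap_diag_le n : expR (- n%:R) * gap n n <= n%:R / e.
Proof.
rewrite mulrBr shortfall_binl_diag lerBlDr lerDl mulr_ge0 ?expR_ge0//.
by apply: sumr_ge0 => c _; apply: pois_ge0.
Qed.

Lemma gapE n k :
  \sum_(0 <= i < k) (k%:R - i%:R) *
    ('C(n, i)%:R * (e - 1) ^+ i - n%:R ^+ i / (i`!)%:R) = gap n k.
Proof.
rewrite sum_shortfall_cumulative /gap /shortfall -sumrB.
by apply: eq_bigr => c _; rewrite sumrB.
Qed.

End GapMonotonicity.

(** * Product weights on subsets and exponential clocks *)

Section ProductWeights.
Context {R : realType} {E : finType}.
Implicit Types (a b x y : E -> R) (f g : {set E} -> R) (S : {set E}) (i : E).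

(** For b = 1 - a this is the probability that the random set containing each i
    independently with probability a i equals S. Keeping b free also covers the
    weights of [clock], in which the probability of absence is factored out. *)
Definition wt a b S : R := \prod_i (if i \in S then a i else b i).

Definition wt_off i a b S : R :=
  \prod_(j | j != i) (if j \in S then a j else b j).

Definition wsum a b f : R := \sum_(S : {set E}) f S * wt a b S.

Lemma multilinear_extE f x : multilinear_ext f x = wsum x (fun i => 1 - x i) f.
Proof.
apply: eq_bigr => S _; rewrite -mulrA; congr (_ * _).
rewrite /wt [RHS](bigID (mem S))/=; congr (_ * _); apply: eq_bigr => i.
  by move=> ->.
by move/negbTE => ->.
Qed.

(** Pair each set avoiding i with the set obtained by adding i. *)
Lemma sum_toggle i (g : {set E} -> R) :
  \sum_(S : {set E}) g S = \sum_(S : {set E} | i \notin S) (g S + g (i |: S)%SET).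
Proof.
rewrite (bigID (fun S : {set E} => i \notin S))/= big_split/=; congr (_ + _).
rewrite (reindex_onto (fun S => i |: S)%SET (fun S => S :\ i)%SET)/=; last first.
  by move=> S; rewrite negbK => iS; rewrite finset.setD1K.
apply: eq_bigl => S; rewrite setU11/=.
apply/eqP/idP => [<-|iS]; first by rewrite !inE eqxx.
by rewrite setU1K.
Qed.

Lemma wt_offE i a b S :
  wt a b S = (if i \in S then a i else b i) * wt_off i a b S.
Proof. by rewrite /wt (bigD1 i). Qed.

Lemma wt_off_toggle i a b S : wt_off i a b (i |: S)%SET = wt_off i a b S.
Proof. by apply: eq_bigr => j /negbTE ji; rewrite !inE ji. Qed.

Lemma eq_wt_off i a b a' b' S :
  (forall j, j != i -> a j = a' j /\ b j = b' j) ->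
  wt_off i a b S = wt_off i a' b' S.
Proof. by move=> h; apply: eq_bigr => j /h[-> ->]. Qed.

Lemma wt_off_ge0 i a b S : (forall j, 0 <= a j) -> (forall j, 0 <= b j) ->
  0 <= wt_off i a b S.
Proof. by move=> a0 b0; apply: prodr_ge0 => j _; case: ifP. Qed.

Lemma wt_ge0 a b S : (forall j, 0 <= a j) -> (forall j, 0 <= b j) ->
  0 <= wt a b S.
Proof. by move=> a0 b0; apply: prodr_ge0 => j _; case: ifP. Qed.

(** Exhibits the dependence on the coordinate i: it is affine, and the factors
    [wt_off] do not involve i. *)
Lemma wsum_split i a b f :
  wsum a b f = \sum_(S : {set E} | i \notin S)
    wt_off i a b S * (b i * f S + a i * f (i |: S)%SET).
Proof.
rewrite /wsum (sum_toggle i); apply: eq_bigr => S /negbTE iS.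
by rewrite !(wt_offE i) wt_off_toggle iS setU11; ring.
Qed.

Lemma sum_wt a b : \sum_(S : {set E}) wt a b S = \prod_i (a i + b i).
Proof. by rewrite bigA_distr. Qed.

Lemma wsumC a b c : wsum a b (fun=> c) = c * \prod_i (a i + b i).
Proof. by rewrite -sum_wt mulr_sumr. Qed.

Lemma wsum_le a b f g : (forall j, 0 <= a j) -> (forall j, 0 <= b j) ->
  (forall S, f S <= g S) -> wsum a b f <= wsum a b g.
Proof. by move=> a0 b0 fg; apply: ler_sum => S _; rewrite ler_wpM2r ?wt_ge0. Qed.

Lemma wsumD a b f g : wsum a b (fun S => f S + g S) = wsum a b f + wsum a b g.
Proof. by rewrite -big_split; apply: eq_bigr => S _; rewrite mulrDl. Qed.

Lemma wsumN a b f : wsum a b (fun S => - f S) = - wsum a b f.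
Proof. by rewrite -sumrN; apply: eq_bigr => S _; rewrite mulNr. Qed.

Lemma wsum_sum a b (n m : nat) (f : nat -> {set E} -> R) :
  wsum a b (fun S => \sum_(m <= c < n) f c S) = \sum_(m <= c < n) wsum a b (f c).
Proof.
rewrite [RHS]exchange_big; apply: eq_bigr => S _.
by rewrite mulr_suml.
Qed.

Lemma prod_marginal i x :
  \sum_(S : {set E} | i \in S) wt x (fun j => 1 - x j) S = x i.
Proof.
rewrite big_mkcond (sum_toggle i)/=.
transitivity (\sum_(S : {set E} | i \notin S) x i * wt_off i x (fun j => 1 - x j) S).
  apply: eq_bigr => S iS; rewrite (negbTE iS) setU11 add0r (wt_offE i).
  by rewrite setU11 wt_off_toggle.
rewrite -mulr_sumr -[RHS]mulr1; congr (_ * _).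
have := wsum_split i x (fun j => 1 - x j) (fun=> 1).
rewrite wsumC mul1r big1; last by move=> j _; rewrite subrKC.
by move=> h; rewrite [RHS]h; apply: eq_bigr => S _; rewrite !mulr1 subrK mulr1.
Qed.

(** Raise the coordinates one at a time, using [wsum_split] at each step. *)
Lemma multilinear_ext_le f x y :
  (forall S T : {set E}, S \subset T -> f S <= f T) ->
  (forall i, 0 <= x i) -> (forall i, x i <= y i) -> (forall i, y i <= 1) ->
  multilinear_ext f x <= multilinear_ext f y.
Proof.
move=> fmon x0 xy y1.
pose h (r : seq E) i := if i \in r then y i else x i.
have hb r i : 0 <= h r i <= 1.
  rewrite /h; case: ifP => _; rewrite ?y1 ?x0 ?andbT//.
    by rewrite (le_trans (x0 i)).
  by rewrite (le_trans (xy i)).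
have step r : multilinear_ext f x <= multilinear_ext f (h r).
  elim: r => [|i r IH]; first exact: lexx.
  apply: le_trans IH _; have [ir|ir] := boolP (i \in r).
    rewrite (_ : h (i :: r) = h r)//; apply/funext => j.
    by rewrite /h inE; case: eqP => // ->; rewrite ir.
  rewrite !multilinear_extE !(wsum_split i); apply: ler_sum => S iS.
  rewrite (@eq_wt_off i _ _ (h (i :: r)) (fun j => 1 - h (i :: r) j)); last first.
    by move=> j /negbTE ji; rewrite /h !inE ji.
  apply: ler_wpM2l.
    by apply: wt_off_ge0 => j; have := hb (i :: r) j; rewrite ?subr_ge0 => /andP[].
  rewrite /h !inE eqxx (negbTE ir)/=.
  have : (y i - x i) * (f S - f (i |: S)%SET) <= 0.
    by rewrite mulr_ge0_le0 ?subr_ge0// subr_le0 fmon// finset.subsetUr.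
  by nra.
rewrite (_ : y = h (index_enum E)) ?step//.
by apply/funext => i; rewrite /h mem_index_enum.
Qed.

Lemma is_derive_bigprod (r : seq E) (u : E -> R -> R) (du : E -> R) (t : R) :
  uniq r -> (forall i, is_derive t 1 (u i) (du i)) ->
  is_derive t 1 (fun s => \prod_(i <- r) u i s)
    (\sum_(i <- r) du i * \prod_(j <- r | j != i) u j t).
Proof.
move=> + ud; elim: r => [|i r IH] /=.
  move=> _; rewrite big_nil (_ : (fun s => _) = cst 1); first exact: is_derive_cst.
  by apply/funext => s; rewrite big_nil.
move=> /andP[ir ur].
rewrite (_ : (fun s => _) = u i * (fun s => \prod_(j <- r) u j s)); last first.
  by apply/funext => s; rewrite big_cons.
refine (@is_derive_eq _ _ _ _ _ _ _ _ (is_deriveM (ud i) (IH ur)) _).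
rewrite /GRing.scale/= !big_cons eqxx/= addrC mulrC; congr (_ + _).
  congr (_ * _); rewrite [LHS]big_seq_cond [RHS]big_seq_cond.
  apply: eq_bigl => j; have [jr|//] := boolP (j \in r).
  by rewrite /= (_ : j != i)//; apply: contraNneq ir => <-.
rewrite mulr_sumr; apply: eq_big_seq => j jr.
rewrite big_cons (_ : i != j); last by apply: contraNneq ir => ->.
by ring.
Qed.

(** The odds that an exponential clock of rate y i has rung by time t. *)
Definition clock y (t : R) : E -> R := fun i => expR (t * y i) - 1.

(** Let i join the current set at rate y i. The generator of this process sends
    g to S |-> sum_i y i * (g (i |: S) - g S); differentiating the factored out
    exp (t * sum y) adds back the terms y i * g S. *)
Lemma is_derive_clock y g (t : R) :
  is_derive t 1 (fun s => wsum (clock y s) (fun=> 1) g)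
    (wsum (clock y t) (fun=> 1) (fun S => \sum_i y i * g (i |: S)%SET)).
Proof.
pose u S i (s : R) := if i \in S then clock y s i else 1.
pose du S i := if i \in S then y i * expR (t * y i) else 0.
have ud S i : is_derive t 1 (u S i) (du S i).
  rewrite /u /du; case: ifP => _; last exact: is_derive_cst.
  have yd : is_derive t (1 : R) (fun s : R => s * y i) (y i).
    have := is_deriveM (is_derive_id t 1) (is_derive_cst (y i) t 1).
    move=> H; refine (@is_derive_eq _ _ _ _ _ _ _ _ H _).
    by rewrite /GRing.scale/= mulr0 add0r mulr1.
  have ed := @is_derive1_comp _ expR _ t _ _ (is_derive_expR (t * y i)) yd.
  refine (@is_derive_eq _ _ _ _ _ _ _ _ (is_deriveB ed (is_derive_cst (1 : R) t 1)) _).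
  by rewrite /GRing.scale/= subr0 mulrC.
have gd (S : {set E}) : is_derive t 1 (fun s => g S * wt (clock y s) (fun=> 1) S)
    (g S * \sum_i du S i * wt_off i (clock y t) (fun=> 1) S).
  have pd := is_derive_bigprod (index_enum_uniq E) (ud S).
  exact: (is_deriveZ (g S) pd).
have := is_derive_bigsum (index_enum {set E}) predT gd.
move=> H; refine (@is_derive_eq _ _ _ _ _ _ _ _ H _).
under eq_bigr do rewrite mulr_sumr.
rewrite exchange_big/=.
transitivity (\sum_i y i * wsum (clock y t) (fun=> 1) (fun S => g (i |: S)%SET)).
  apply: eq_bigr => i _; rewrite (wsum_split i) (sum_toggle i) mulr_sumr.
  apply: eq_bigr => S iS; rewrite /du (negbTE iS) setU11 wt_off_toggle.
  by rewrite finset.setUA finset.setUid /clock; ring.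
rewrite /wsum; under eq_bigr do rewrite mulr_sumr.
rewrite exchange_big; apply: eq_bigr => S _.
by rewrite mulr_suml; apply: eq_bigr => i _; rewrite mulrA.
Qed.

Lemma clock_multilinear y f :
  multilinear_ext f (fun i => 1 - expR (- y i))
    = expR (- \sum_i y i) * wsum (clock y 1) (fun=> 1) f.
Proof.
rewrite multilinear_extE /wsum mulr_sumr; apply: eq_bigr => S _.
rewrite mulrCA; congr (_ * _).
have -> : expR (- \sum_i y i) = \prod_i expR (- y i).
  by rewrite -sumrN expR_sum.
rewrite /wt -big_split/=; apply: eq_bigr => i _.
rewrite /clock mul1r; case: ifP => _; last by rewrite mulr1 opprB addrCA subrr addr0.
by rewrite mulrBr mulr1 -expRD addNr expR0.
Qed.

Lemma wsum_clock0 y g : wsum (clock y 0) (fun=> 1) g = g finset.set0.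
Proof.
rewrite /wsum (bigD1 finset.set0)//= big1 ?addr0; last first.
  move=> S /set0Pn[i iS].
  by rewrite (wt_offE i) iS /clock mul0r expR0 subrr mul0r mulr0.
by rewrite /wt big1 ?mulr1// => i _; rewrite inE.
Qed.

End ProductWeights.

(** * Replacing Bernoulli variables by Poisson variables *)

Section BernoulliPoisson.
Context {R : realType} {E : finType}.
Implicit Types (x : E -> R).

Lemma sum_setzero x i :
  \sum_j (if j == i then 0 else x j) = \sum_j x j - x i.
Proof.
rewrite (bigD1 i)//= eqxx add0r [in RHS](bigD1 i)//= addrAC subrr add0r.
by apply: eq_bigr => j /negbTE ->.
Qed.

(** Induction on the number of nonzero coordinates: [shortfall_pois_tangent]
    moves the mean of one Bernoulli coordinate into the Poisson part l, which
    starts at 0 and ends with the whole sum. *)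
Lemma poisson_replacement x (l : R) k : (forall i, 0 <= x i <= 1) -> 0 <= l ->
  multilinear_ext (fun S => expR (- l) * shortfall (pois l) (k - #|S|)) x
    <= expR (- (l + \sum_i x i)) * shortfall (pois (l + \sum_i x i)) k.
Proof.
elim: {x}_.+1 {-2}x (ltnSn #|[set i | x i != 0]|) l => // N IH x xN l x01 l0.
have [/existsP[i xi0]|] := boolP [exists i, x i != 0]; last first.
  rewrite negb_exists => /forallP x0.
  have {}x0 i : x i = 0 by apply/eqP; have := x0 i; rewrite negbK.
  rewrite big1// addr0 multilinear_extE /wsum.
  rewrite (bigD1 finset.set0)//= big1 ?addr0; last first.
    move=> S /set0Pn[i iS]; rewrite (wt_offE i) iS x0 mul0r mulr0//.
  rewrite cards0 subn0 /wt big1 ?mulr1// => i _.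
  by rewrite inE x0 subr0.
pose z j := if j == i then 0 else x j.
have xi_ge0 : 0 <= x i by case/andP: (x01 i).
have -> : l + \sum_j x j = (l + x i) + \sum_j z j by rewrite sum_setzero; ring.
apply: le_trans (IH z _ _ _ _); last 3 first.
- rewrite -ltnS; apply: leq_trans xN; rewrite ltnS; apply: proper_card.
  apply/properP; split.
    by apply/fintype.subsetP => j; rewrite !inE /z; case: (j == i); rewrite ?eqxx.
  by exists i; rewrite !inE /z ?eqxx.
- by move=> j; rewrite /z; case: eqP => _ //; rewrite lexx ler01.
- exact: addr_ge0.
rewrite !multilinear_extE !(wsum_split i); apply: ler_sum => S iS.
rewrite (@eq_wt_off _ _ i _ _ z (fun j => 1 - z j)); last first.
  by move=> j /negbTE ji; rewrite /z ji.
apply: ler_wpM2l.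
  apply: wt_off_ge0 => j; rewrite /z; case: eqP => _ //; rewrite ?subr0//.
    by case/andP: (x01 j).
  by rewrite subr_ge0; case/andP: (x01 j).
rewrite /z eqxx subr0 mul1r mul0r addr0 cardsU1 iS add1n subnS.
case: (k - #|S|)%N => [|c]; first by rewrite /= !shortfall0 !mulr0 addr0.
by have := shortfall_pois_tangent c l0 xi_ge0; rewrite /=; lra.
Qed.

Lemma expected_shortfall_le x k : (forall i, 0 <= x i <= 1) ->
  multilinear_ext (fun S => (k - #|S|)%:R) x
    <= expR (- \sum_i x i) * shortfall (pois (\sum_i x i)) k.
Proof.
move=> x01; have := poisson_replacement k x01 (lexx 0).
rewrite add0r; congr (_ <= _); apply: eq_bigr => S _; do 2 congr (_ * _).
rewrite oppr0 expR0 mul1r; elim: (k - _)%N => [|c IH]; first by rewrite shortfall0.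
by rewrite shortfallS IH pois_0 natr1.
Qed.

End BernoulliPoisson.

(** * Rank functions of matroids *)

Section MatroidRank.
Context {E : finType} (M : matroid E).
Implicit Types (A B I J S T : {set E}) (i : E).

Local Notation r := (rank M).

Lemma rank_ge_indep I S : indep M I -> I \subset S -> (#|I| <= r S)%N.
Proof.
by move=> MI IS; rewrite /rank (@leq_bigmax_cond _ _ (fun J : {set E} => #|J|)) ?IS.
Qed.

Lemma indep_extend I S : indep M I -> I \subset S ->
  exists J, [/\ I \subset J, J \subset S, indep M J & #|J| = r S].
Proof.
move=> MI IS.
have [] := @eq_bigmax_cond _ [pred J : {set E} | (J \subset S) && indep M J]
  (fun J : {set E} => #|J|).
  by apply/card_gt0P; exists I; rewrite inE IS.
move=> B; rewrite inE => /andP[BS MB] rE.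
have {}rE : r S = #|B| by [].
elim: {I}_.+1 {-2}I (ltnSn (#|B| - #|I|)) MI IS => // N IH I IN MI IS.
have [BI|IB] := leqP #|B| #|I|.
  exists I; split => //; apply/eqP.
  by rewrite eqn_leq rE BI -rE rank_ge_indep.
have [b] := indep_augment MI MB IB; rewrite inE => /andP[bI bB] MbI.
have bIN : (#|B| - #|b |: I|%SET < N)%N by rewrite cardsU1 bI; lia.
have bIS : (b |: I)%SET \subset S.
  by rewrite finset.subUset finset.sub1set (fintype.subsetP BS).
have [J [IJ JS MJ JE]] := IH _ bIN MbI bIS.
by exists J; split => //; apply: fintype.subset_trans IJ; apply: finset.subsetUr.
Qed.

Lemma rank_basis S : exists I, [/\ I \subset S, indep M I & #|I| = r S].
Proof.
have [J [_ JS MJ JE]] := indep_extend (indep_set0 M) (finset.sub0set S).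
by exists J.
Qed.

Lemma rank_indep I : indep M I -> r I = #|I|.
Proof.
move=> MI; have [J [IJ JI _ <-]] := indep_extend MI (fintype.subxx I).
by apply/eqP; rewrite eqn_leq !subset_leq_card.
Qed.

Lemma rank_le_card S : (r S <= #|S|)%N.
Proof. by have [I [IS _ <-]] := rank_basis S; apply: subset_leq_card. Qed.

Lemma rank0 : r finset.set0 = 0%N.
Proof. by apply/eqP; rewrite -leqn0 -(cards0 E) rank_le_card. Qed.

Lemma rank_mono S T : S \subset T -> (r S <= r T)%N.
Proof.
have [I [IS MI <-]] := rank_basis S => ST.
by apply: rank_ge_indep => //; apply: fintype.subset_trans ST.
Qed.

Lemma rank_submodular A B : (r (A :|: B)%SET + r (A :&: B)%SET <= r A + r B)%N.
Proof.
have [I [IAB MI <-]] := rank_basis (A :&: B)%SET.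
have IU : I \subset (A :|: B)%SET.
  apply: (fintype.subset_trans IAB).
  by apply: (fintype.subset_trans (finset.subsetIl _ _)); apply: finset.subsetUl.
have [J [IJ JU MJ <-]] := indep_extend MI IU.
have capI C : (#|J :&: C|%SET <= r C)%N.
  apply: rank_ge_indep (finset.subsetIr _ _).
  by apply: indep_subset MJ; apply: finset.subsetIl.
apply: leq_trans (leq_add (capI A) (capI B)).
rewrite -(cardsUI (J :&: A)%SET) leq_add//; apply: subset_leq_card.
  by rewrite -finset.setIUr finset.subsetI fintype.subxx.
rewrite finset.subsetI; move: IAB; rewrite finset.subsetI => /andP[IA IB].
by rewrite !finset.subsetI IJ IA IB.
Qed.

(** If an independent J inside the closure of S were larger than a basis I of S,
    augmenting I from J would produce an element that does raise the rank
    of S. *)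
Lemma rank_span S :
  r [set i | r (i |: S)%SET == r S]%SET = r S.
Proof.
set C := [set i | _]%SET.
have SC : S \subset C.
  apply/fintype.subsetP => i iS; rewrite inE (finset.setUidPr _)//.
  by rewrite finset.sub1set.
apply/eqP; rewrite eqn_leq (rank_mono SC) andbT leqNgt; apply/negP => lt.
have [I [IS MI IE]] := rank_basis S; have [J [JC MJ JE]] := rank_basis C.
have IJ : (#|I| < #|J|)%N by rewrite IE JE.
have [b] := indep_augment MI MJ IJ; rewrite inE => /andP[bI bJ] MbI.
have : b \in C by apply: (fintype.subsetP JC).
rewrite inE => /eqP rb.
have : (#|b |: I|%SET <= r (b |: S)%SET)%N.
  exact: (rank_ge_indep MbI (finset.setUS _ IS)).
by rewrite rb cardsU1 bI IE; lia.
Qed.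

Lemma girth_indep k S : has_girth M k.+1 -> (#|S| <= k)%N -> indep M S.
Proof. by move=> [_ h] Sk; apply/negPn/negP => /h; rewrite leqNgt ltnS Sk. Qed.

Lemma girth_rank_ge k S : has_girth M k.+1 -> (k <= #|S|)%N -> (k <= r S)%N.
Proof.
move=> Mk kS.
have [A AS Ak] : exists2 A : {set E}, A \subset S & #|A| = k.
  elim: {S}_.+1 {-2}S (ltnSn (#|S| - k)) kS => // N IH S SN kS.
  have [Sk|kS'] := leqP #|S| k; first by exists S => //; apply/eqP; rewrite eqn_leq Sk.
  (* Discard elements until k are left. *)
  have [x xS] : exists x, x \in S by apply/set0Pn; rewrite -card_gt0; lia.
  have cS := cardsD1 x S; rewrite xS/= in cS.
  have [||A AS Ak] := IH (S :\ x)%SET; try lia.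
  by exists A => //; apply: fintype.subset_trans AS (finset.subsetDl _ _).
by rewrite -{1}Ak rank_ge_indep//; apply: (girth_indep Mk); rewrite Ak.
Qed.

Lemma girth_le_rank k : has_girth M k.+1 -> (k <= r [set: E]%SET)%N.
Proof.
move=> Mk; have [[C _ CE] _] := Mk.
by apply: (leq_trans (girth_rank_ge (S := C) Mk _)); rewrite ?CE ?rank_mono ?finset.subsetT.
Qed.

Lemma loopless_girth_gt1 g : loopless M -> has_girth M g -> (1 < g)%N.
Proof.
move=> nl [[C Cdep <-] _]; rewrite ltnNge; apply: contra Cdep.
rewrite leq_eqVlt => /orP[/cards1P[i ->]|]; first exact: nl.
by rewrite ltnS leqn0 cards_eq0 => /eqP ->; apply: indep_set0.
Qed.

End MatroidRank.

(** * Tight points of the independence polytope *)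

Section IndependencePolytope.
Context {R : realType} {E : finType} (M : matroid E).
Implicit Types (y : E -> R) (S T : {set E}) (i : E).

Local Notation r := (rank M).
Local Notation rankR := (fun S : {set E} => (rank M S)%:R : R).

Definition in_polytope y :=
  (forall i, 0 <= y i) /\ (forall S, \sum_(i in S) y i <= (r S)%:R).

Lemma in_polytope01 y i : in_polytope y -> 0 <= y i <= 1.
Proof.
move=> [y0 yS]; rewrite y0/=; have := yS [set i]%SET; rewrite big_set1.
move/le_trans; apply; rewrite lern1.
by apply: leq_trans (rank_le_card _ _) _; rewrite cards1.
Qed.

(** The elements that do not raise the rank of S form its closure, which has
    the rank of S, so their total y-mass is at most r(S). *)
Lemma rank_rate_ge y S : in_polytope y ->
  \sum_i y i - (r S)%:R <= \sum_(i | r (i |: S)%SET != r S) y i.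
Proof.
move=> [y0 yS]; rewrite (bigID (fun i => r (i |: S)%SET == r S))/=.
rewrite addrC lerBlDr lerD2l.
have := yS [set i | r (i |: S)%SET == r S]%SET; rewrite rank_span.
by congr (_ <= _); apply: eq_bigl => i; rewrite inE.
Qed.

Definition rank_lt (c : nat) S : R := (r S < c)%:R.

(** Only the sets with r(S) = c leave the event r < c + 1, and by
    [rank_rate_ge] they do so at rate at least n - c. The coefficients are those
    of [is_derive_binl]. *)
Lemma rank_lt_rate_le y (n c : nat) S : in_polytope y -> \sum_i y i = n%:R ->
  (c <= n)%N ->
  \sum_i y i * rank_lt c.+1 (i |: S)%SET
    <= c%:R * rank_lt c.+1 S + (n - c)%:R * rank_lt c S.
Proof.
move=> yP yn cn; have [y0 _] := yP.
have [rc|rc|rc] := ltngtP (r S) c.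
- have -> : rank_lt c.+1 S = 1 by rewrite /rank_lt ltnS ltnW.
  have -> : rank_lt c S = 1 by rewrite /rank_lt rc.
  rewrite !mulr1 -natrD subnKC// -yn; apply: ler_sum => i _.
  by rewrite ler_piMr// /rank_lt lern1 leq_b1.
- rewrite /rank_lt big1 ?addr_ge0// => i _; rewrite (_ : (_ < _)%N = false) ?mulr0//.
  apply/negbTE; rewrite -leqNgt; apply: leq_trans rc _.
  by apply: rank_mono; apply: finset.subsetUr.
rewrite /rank_lt rc ltnSn ltnn mulr1 mulr0 addr0.
have rate := rank_rate_ge S yP; move: rate; rewrite rc yn.
have : \sum_i y i * rank_lt c.+1 (i |: S)%SET <= \sum_(i | r (i |: S)%SET == r S) y i.
  rewrite [leRHS]big_mkcond/=; apply: ler_sum => i _; rewrite /rank_lt.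
  have [->|ne] := eqVneq (r (i |: S)%SET) (r S); first by rewrite rc ltnSn mulr1.
  have ge : (r S <= r (i |: S)%SET)%N by apply: rank_mono; apply: finset.subsetUr.
  by rewrite ltnS leqNgt (_ : (c < _)%N) ?mulr0// -rc ltn_neqAle eq_sym ne.
have := yn; rewrite (bigID (fun i => r (i |: S)%SET == r S))/=.
rewrite /rank_lt rc; lra.
Qed.

(** The rank under clocks of rates y dominates the number of rung clocks among n
    of rate 1. By induction on c, the difference of the two sides satisfies the
    hypotheses of [gronwall_ge0]. *)
Lemma clock_rank_lt_le y (n c : nat) (t : R) : in_polytope y ->
  \sum_i y i = n%:R -> (c <= n.+1)%N -> 0 <= t ->
  wsum (clock y t) (fun=> 1) (rank_lt c) <= binl (expR t - 1) n c.
Proof.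
move=> yP yn; have [y0 _] := yP.
have ck0 s i : 0 <= s -> 0 <= clock y s i.
  by move=> s0; rewrite /clock subr_ge0 -{1}expR0 ler_expR mulr_ge0.
elim: c t => [|c IH] t cn t0.
  by rewrite binl0 /wsum big1// => S _; rewrite /rank_lt ltn0 mul0r.
rewrite ltnS in cn; rewrite -subr_ge0.
pose f s := binl (expR s - 1) n c.+1 - wsum (clock y s) (fun=> 1) (rank_lt c.+1).
have fd (s : R) := is_deriveB (is_derive_binl s cn) (is_derive_clock y (rank_lt c.+1) s).
apply: (gronwall_ge0 (f := f) (a := c%:R) t0 fd).
  rewrite /f wsum_clock0 expR0 subrr /rank_lt rank0 ltn0Sn.
  by rewrite /binl big_nat_recl// bin0 expr0 mulr1 big1 ?addr0 ?subrr// => i _;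
    rewrite expr0n mulr0.
move=> s s0; rewrite /f.
have h : wsum (clock y s) (fun=> 1) (fun S => \sum_i y i * rank_lt c.+1 (i |: S)%SET)
   <= c%:R * wsum (clock y s) (fun=> 1) (rank_lt c.+1)
      + (n - c)%:R * wsum (clock y s) (fun=> 1) (rank_lt c).
  rewrite /wsum !mulr_sumr -big_split/=; apply: ler_sum => S _.
  rewrite !mulrA -mulrDl ler_wpM2r ?rank_lt_rate_le//.
  by apply: wt_ge0 => // i; apply: ck0.
have := ler_wpM2l (ler0n R (n - c)) (IH s (leqW cn) s0).
move: h; lra.
Qed.

Lemma sum_ltn_tail (k n m : nat) : (k <= n)%N ->
  \sum_(k <= c < n) (1 - (m < c.+1)%:R) = (minn m n - k)%:R :> R.
Proof.
elim: n => [|n IH]; first by rewrite leqn0 => /eqP ->; rewrite big_nil minn0.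
rewrite leq_eqVlt => /predU1P[->|].
  by rewrite big_geq// (_ : (_ - _)%N = 0%N)//; lia.
rewrite ltnS => kn; rewrite big_nat_recr//= IH// ltnS.
have [mn|nm] := leqP m n; first by rewrite subrr addr0 (minn_idPl (leqW mn)).
rewrite subr0 natr1; congr _%:R; lia.
Qed.

(** The first two terms are min(|S|, k) and the sum is the excess of
    min(r(S), n) over k. A set with at most k elements is independent, and a
    larger one has rank at least k. *)
Lemma rank_ge_tail k n S : has_girth M k.+1 -> (k <= n)%N ->
  k%:R - (k - #|S|)%:R + \sum_(k <= c < n) (1 - rank_lt c.+1 S) <= (r S)%:R.
Proof.
move=> Mk kn; rewrite /rank_lt sum_ltn_tail// -natrB ?leq_subr// -natrD ler_nat.
have [Sk|/ltnW kS] := leqP #|S| k.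
  by rewrite (rank_indep (girth_indep Mk Sk)); lia.
by have := girth_rank_ge Mk kS; lia.
Qed.

(** The event r(S) >= c is monotone, so the probabilities y i may be lowered to
    those of the clocks at time 1. *)
Lemma expected_tail_ge y (n c : nat) : in_polytope y -> \sum_i y i = n%:R ->
  (c <= n)%N ->
  1 - expR (- n%:R) * binl (expR 1 - 1) n c
    <= multilinear_ext (fun S => 1 - rank_lt c S) y.
Proof.
move=> yP yn cn; have [y0 _] := yP; pose x i := 1 - expR (- y i).
have xy i : x i <= y i.
  by rewrite /x lerBlDr -lerBlDl; have := expR_ge1Dx (- y i); lra.
have x0 i : 0 <= x i by rewrite /x subr_ge0 -expR0 ler_expR oppr_le0.
have y1 i : y i <= 1 by case/andP: (in_polytope01 i yP).
apply: le_trans (multilinear_ext_le _ x0 xy y1); last first.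
  move=> S T ST; rewrite lerD2l lerN2 ler_nat /rank_lt.
  by have := rank_mono M ST; lia.
rewrite clock_multilinear yn wsumD wsumC wsumN mul1r mulrBr.
have -> : \prod_i (clock y 1 i + 1) = expR n%:R.
  by rewrite -yn expR_sum; apply: eq_bigr => i _; rewrite /clock subrK mul1r.
rewrite -expRD addNr expR0 lerD2l lerN2 ler_wpM2l ?expR_ge0//.
by apply: clock_rank_lt_le => //; rewrite leqW.
Qed.

Lemma multilinear_rank_ge k n y : has_girth M k.+1 -> in_polytope y ->
  \sum_i y i = n%:R -> (k <= n)%N ->
  n%:R * (1 - 1 / expR 1) + expR (- n%:R) * gap n k
    <= multilinear_ext rankR y.
Proof.
move=> Mk yP yn kn; have y01 i := in_polytope01 i yP.
have y0 i : 0 <= y i by case/andP: (y01 i).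
have y1 i : 0 <= 1 - y i by rewrite subr_ge0; case/andP: (y01 i).
rewrite multilinear_extE.
apply: le_trans (wsum_le y0 y1 (fun S => rank_ge_tail S Mk kn)).
rewrite wsumD wsum_sum wsumD wsumC wsumN -!multilinear_extE.
rewrite big1 ?mulr1; last by move=> i _; rewrite subrKC.
have sh := expected_shortfall_le k y01; rewrite yn in sh.
have tl : \sum_(k <= c < n) (1 - expR (- n%:R) * binl (expR 1 - 1) n c.+1)
    <= \sum_(k <= c < n) wsum y (fun i => 1 - y i) (fun S => 1 - rank_lt c.+1 S).
  apply: ler_sum_nat => c /andP[_ cn]; rewrite -multilinear_extE.
  exact: expected_tail_ge.
rewrite -lerN2 in sh.
apply: le_trans (lerD (lerD (lexx _) sh) tl).
rewrite sumrB sumr_const_nat -mulr_sumr natrB//.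
have cat := shortfall_cat (binl (expR 1 - 1) n) kn.
have := @shortfall_binl_diag R n; rewrite cat mulrDr /gap.
lra.
Qed.

(** The random set meets T in an independent set, of expected size y(T). *)
Lemma multilinear_rank_small k T y : has_girth M k.+1 -> in_polytope y ->
  (#|T| <= k)%N -> \sum_(i in T) y i <= multilinear_ext rankR y.
Proof.
move=> Mk yP Tk; have y01 i := in_polytope01 i yP.
have y0 i : 0 <= y i by case/andP: (y01 i).
have y1 i : 0 <= 1 - y i by rewrite subr_ge0; case/andP: (y01 i).
rewrite multilinear_extE; under eq_bigr do rewrite -prod_marginal.
rewrite (exchange_big_dep predT)//=; apply: ler_sum => S _.
rewrite sumr_const -[_ *+ #|_|]mulr_natl ler_wpM2r ?wt_ge0// ler_nat.
rewrite (_ : #|_| = #|T :&: S|%SET); last by apply: eq_card => i; rewrite inE.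
apply: rank_ge_indep (finset.subsetIr _ _); apply: (girth_indep Mk).
by apply: leq_trans Tk; apply: subset_leq_card; apply: finset.subsetIl.
Qed.

End IndependencePolytope.

(** * Reduction to tight points *)

Section TightReduction.
Context {R : realType} {E : finType} (M : matroid E).
Implicit Types (y : E -> R) (S T : {set E}) (i : E).

Local Notation r := (rank M).

Definition upd y i (v : R) : E -> R := fun j => if j == i then v else y j.

Lemma upd_id y i : upd y i (y i) = y.
Proof. by apply/funext => j; rewrite /upd; case: eqP => [->|]. Qed.

Lemma multilinear_ext_upd (f : {set E} -> R) y i v :
  multilinear_ext f (upd y i v)
    = (1 - v) * multilinear_ext f (upd y i 0) + v * multilinear_ext f (upd y i 1).
Proof.
rewrite !multilinear_extE !(wsum_split i) !mulr_sumr -big_split/=.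
apply: eq_bigr => S _.
have off u : wt_off i (upd y i u) (fun j => 1 - upd y i u j) S
    = wt_off i y (fun j => 1 - y j) S.
  by apply: eq_wt_off => j /negbTE ji; rewrite /upd ji.
by rewrite !off /upd eqxx; ring.
Qed.

Lemma sum_upd y i v S :
  \sum_(j in S) upd y i v j = \sum_(j in S) y j + (if i \in S then v - y i else 0).
Proof.
case: ifP => iS; last first.
  rewrite addr0; apply: eq_bigr => j jS; rewrite /upd; case: eqP => // ji.
  by rewrite -ji jS in iS.
rewrite (bigD1 i)//= [in RHS](bigD1 i)//= /upd eqxx addrAC subrKC.
by congr (_ + _); apply: eq_bigr => j /andP[_ /negbTE ->].
Qed.

Lemma sum_upd_all y i v : \sum_j upd y i v j = \sum_j y j + (v - y i).
Proof.
have := sum_upd y i v [set: E]%SET; rewrite inE => h.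
have sT (x : E -> R) : \sum_(j in [set: E]%SET) x j = \sum_j x j.
  by apply: eq_bigl => j; rewrite inE.
by rewrite -!sT h.
Qed.

Definition tight y T : bool := \sum_(i in T) y i == (r T)%:R.

(** The elements that [ler_multilinear_tight] has to move. *)
Definition loose y : {set E} :=
  [set i | (y i != 0) && ~~ [exists T : {set E}, (i \in T) && tight y T]]%SET.

(** Uncrossing: y is modular and the rank is submodular. *)
Lemma tightU y A B : in_polytope M y -> tight y A -> tight y B ->
  tight y (A :|: B)%SET.
Proof.
move=> [y0 yS] /eqP tA /eqP tB; apply/eqP/le_anti; rewrite yS/=.
have sub : ((r (A :|: B)%SET)%:R + (r (A :&: B)%SET)%:R <= (r A)%:R + (r B)%:R :> R).
  by rewrite -!natrD ler_nat rank_submodular.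
have mod : \sum_(i in (A :|: B)%SET) y i + \sum_(i in (A :&: B)%SET) y i
    = \sum_(i in A) y i + \sum_(i in B) y i.
  rewrite !(big_mkcond (fun i => i \in _)) -!big_split/=; apply: eq_bigr => i _.
  by rewrite !inE; case: (i \in A); case: (i \in B); rewrite /= ?addr0 ?add0r.
have := yS (A :&: B)%SET; rewrite -tA -tB in sub; rewrite -mod in sub.
by move: sub; lra.
Qed.

Lemma tight_support y : in_polytope M y -> loose y = finset.set0 ->
  exists2 T, tight y T & \sum_i y i = \sum_(i in T) y i.
Proof.
move=> yP l0; pose T := (\bigcup_(S : {set E} | tight y S) S)%SET.
exists T.
  apply: (big_ind (fun S => tight y S)) => //.
    by rewrite /tight rank0 big1// => i; rewrite inE.
  by move=> A B; apply: tightU.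
rewrite [RHS]big_mkcond; apply: eq_bigr => i _; case: ifPn => // iT.
have : i \notin loose y by rewrite l0 inE.
rewrite inE negb_and !negbK => /orP[/eqP //|/existsP[S /andP[iS tS]]].
by case/negP: iT; apply/bigcupP; exists S.
Qed.

(** Move a loose element i, either to 0 or up by the smallest slack c of a set
    containing i. Since i is in no tight set, all tight sets stay tight, and in
    both cases i is no longer loose. As y is a convex combination of the two new
    points, with weights proportional to c and y i, and both sides are affine
    along this segment, the inequality at y follows. *)
Lemma ler_multilinear_tight (f : {set E} -> R) (b : R) :
  (forall y T, in_polytope M y -> tight y T -> \sum_i y i = \sum_(i in T) y i ->
     b * \sum_i y i <= multilinear_ext f y) ->
  forall y, in_polytope M y -> b * \sum_i y i <= multilinear_ext f y.
Proof.
move=> base y; elim: {y}_.+1 {-2}y (ltnSn #|loose y|) => // N IH y yN yP.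
have [l0|[i il]] := set_0Vmem (loose y).
  by have [T tT sT] := tight_support yP l0; apply: base tT sT.
have := il; rewrite inE => /andP[yi0 /existsPn nt].
have [y0 yS] := yP.
have {}yi0 : 0 < y i by rewrite lt_neqAle eq_sym yi0 y0.
pose slack T := (r T)%:R - \sum_(j in T) y j.
have iT : i \in [set: E]%SET by rewrite inE.
(* The whole ground set contains i, so that the minimum is over a nonempty
   family. *)
have [T0 iT0 T0min] := arg_minP slack (P := fun T : {set E} => i \in T) iT.
pose c := slack T0.
have c0 : 0 < c.
  rewrite /c /slack subr_gt0 lt_neqAle yS andbT.
  by have := nt T0; rewrite iT0.
have smaller z : (forall j, j \in loose z -> (j != i) && (j \in loose y)) ->
    (#|loose z| < N)%N.
  move=> h; rewrite ltnS in yN; apply: leq_trans yN; apply: proper_card.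
  apply/properP; split; first by apply/fintype.subsetP => j /h /andP[].
  by exists i => //; apply/negP => /h /andP[/eqP].
pose z0 := upd y i 0; pose z1 := upd y i (y i + c).
have z0P : in_polytope M z0.
  split=> [j|S]; first by rewrite /z0 /upd; case: eqP.
  rewrite /z0 sum_upd; have := yS S; case: ifP => _; lra.
have z1P : in_polytope M z1.
  split=> [j|S]; first by rewrite /z1 /upd; case: eqP => // _; rewrite addr_ge0// ltW.
  rewrite /z1 sum_upd; case: ifP => iS; last by rewrite addr0.
  have := T0min S iS; rewrite -/c /slack; lra.
have sub0 : (#|loose z0| < N)%N.
  apply: smaller => j; rewrite inE => /andP[zj /existsPn nz].
  have ji : j != i by apply: contraNneq zj => ->; rewrite /z0 /upd eqxx.
  move: zj; rewrite inE ji/= /z0 {1}/upd (negbTE ji) => -> /=.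
  apply/existsPn => S; apply/negP => /andP[jS tS].
  have /negP := nz S; apply; rewrite jS/=.
  have := nt S; rewrite tS andbT => /negbTE iS.
  by rewrite /tight sum_upd iS addr0.
have sub1 : (#|loose z1| < N)%N.
  apply: smaller => j; rewrite inE => /andP[zj /existsPn nz].
  have ji : j != i.
    apply/eqP => ji; have := nz T0; rewrite ji iT0 /tight sum_upd iT0 /c /slack.
    by case/eqP; ring.
  move: zj; rewrite inE ji/= /z1 {1}/upd (negbTE ji) => -> /=.
  apply/existsPn => S; apply/negP => /andP[jS tS].
  have /negP := nz S; apply; rewrite jS/=.
  have := nt S; rewrite tS andbT => /negbTE iS.
  by rewrite /tight sum_upd iS addr0.
have h0 := IH z0 sub0 z0P; have h1 := IH z1 sub1 z1P.
rewrite -(upd_id y i) (multilinear_ext_upd _ _ _ (y i)).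
rewrite /z1 multilinear_ext_upd !sum_upd_all in h1.
rewrite /z0 !sum_upd_all in h0.
rewrite upd_id.
move: h0 h1.
set F0 := multilinear_ext f (upd y i 0); set F1 := multilinear_ext f (upd y i 1).
set s := \sum_j y j => h0 h1.
have yc : 0 < y i + c by rewrite addr_gt0.
(* The convex combination, multiplied by y i + c. *)
rewrite -(ler_pM2l yc).
have := ler_wpM2l (ltW c0) h0; have := ler_wpM2l (ltW yi0) h1.
nra.
Qed.

End TightReduction.

(** * From the polytope to the correlation gap *)

Section CorrelationGap.
Context {R : realType} {E : finType} (M : matroid E).
Implicit Types (x y : E -> R) (S T : {set E}).

Local Notation r := (rank M).
Local Notation rankR := (fun S : {set E} => (rank M S)%:R : R).
Local Notation e := (expR 1 : R).

Lemma concave_feasible_wt x : (forall i, 0 <= x i <= 1) ->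
  concave_feasible x (wt x (fun i => 1 - x i)).
Proof.
move=> x01; split; first by move=> i; apply: prod_marginal.
  by rewrite sum_wt big1// => i _; rewrite subrKC.
by move=> S; apply: wt_ge0 => i; rewrite ?subr_ge0; case/andP: (x01 i).
Qed.

(** Replace each set S of the decomposition by a basis of S. *)
Lemma feasible_polytope x lam : concave_feasible x lam ->
  exists y, [/\ in_polytope M y, forall i, y i <= x i
              & \sum_i y i = \sum_(S : {set E}) lam S * (r S)%:R].
Proof.
move=> [lamx lam1 lam0].
have [B HB] := boolp.choice (fun S => rank_basis M S).
pose y i := \sum_(S : {set E} | i \in B S) lam S.
have yT T : \sum_(i in T) y i = \sum_(S : {set E}) lam S * #|T :&: B S|%SET%:R.
  rewrite (exchange_big_dep predT)//=; apply: eq_bigr => S _.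
  rewrite sumr_const mulr_natr; congr (_ *+ _).
  by apply: eq_card => i; rewrite inE.
exists y; split.
- split=> [i|T]; first exact: sumr_ge0.
  rewrite yT; apply: (@le_trans _ _ (\sum_(S : {set E}) lam S * (r T)%:R)).
    apply: ler_sum => S _; rewrite ler_wpM2l// ler_nat.
    apply: rank_ge_indep (finset.subsetIl _ _).
    by have [_ MB _] := HB S; apply: indep_subset MB; apply: finset.subsetIr.
  by rewrite -mulr_suml lam1 mul1r.
- move=> i; rewrite -lamx /y big_mkcond [leRHS]big_mkcond/=.
  apply: ler_sum => S _; have [BS _ _] := HB S.
  case: ifP => [iB|_]; last by case: ifP.
  by rewrite (fintype.subsetP BS).
- have sT : \sum_i y i = \sum_(i in [set: E]%SET) y i.
    by apply: eq_bigl => i; rewrite inE.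
  rewrite sT yT; apply: eq_bigr => S _; rewrite finset.setTI.
  by have [_ _ ->] := HB S.
Qed.

(** The product weights are feasible, so the concave extension is at least the
    multilinear one. In particular it is positive unless both vanish, and then
    their ratio is 1 by convention. *)
Lemma correlation_gap_rank_ge (b : R) : 0 < b -> b <= 1 ->
  (forall y, in_polytope M y -> b * \sum_i y i <= multilinear_ext rankR y) ->
  b <= correlation_gap rankR.
Proof.
move=> b0 b1 hb; apply: lb_le_inf.
  exists (ratio01 (multilinear_ext rankR (fun=> 0)) (concave_ext rankR (fun=> 0))).
  by exists (fun=> 0) => // i; rewrite lexx ler01.
move=> _ [x x01 ->].
set F := multilinear_ext _ _; set C := concave_ext _ _.
have ub (v : R) : (exists2 lam : {set E} -> R, concave_feasible x lam &
    v = \sum_(S : {set E}) lam S * (r S)%:R) -> v <= F / b.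
  move=> [lam lamP ->]; have [y [yP yx <-]] := feasible_polytope lamP.
  rewrite ler_pdivlMr// mulrC; apply: le_trans (hb y yP) _.
  apply: multilinear_ext_le yx _ => [S T ST|i|i].
  - by rewrite ler_nat rank_mono.
  - by case: yP.
  - by case/andP: (x01 i).
have FC : F <= C.
  apply: ub_le_sup; first by exists (F / b) => v; apply: ub.
  exists (wt x (fun i => 1 - x i)); first exact: concave_feasible_wt.
  by rewrite /F multilinear_extE; apply: eq_bigr => S _; rewrite mulrC.
have CF : C <= F / b.
  apply: ge_sup => [|v]; last exact: ub.
  exists (\sum_(S : {set E}) wt x (fun i => 1 - x i) S * (r S)%:R).
  by exists (wt x (fun i => 1 - x i)) => //; exact: concave_feasible_wt.
have F0 : 0 <= F.
  rewrite /F multilinear_extE; apply: sumr_ge0 => S _.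
  by rewrite mulr_ge0// wt_ge0// => i; rewrite ?subr_ge0; case/andP: (x01 i).
rewrite /ratio01; case: ifPn => // FC0.
have C0 : 0 < C.
  rewrite lt_neqAle (le_trans F0 FC) andbT; apply: contraNneq FC0 => C0.
  by rewrite -C0 eqxx andbT eq_le F0 andbT C0.
by rewrite ler_pdivlMr// mulrC -ler_pdivlMr.
Qed.

(** By monotonicity in n only n = k matters, where the binomial shortfall is
    k / e. *)
Lemma ratio_bound_le1 n k : (0 < k)%N -> (k <= n)%N ->
  1 - 1 / e + expR (- n%:R) / n%:R * gap n k <= 1.
Proof.
move=> k0 kn; have kR : 0 < k%:R :> R by rewrite ltr0n.
have := @gap_ratio_le R k n k k0 kn.
have : expR (- k%:R) / k%:R * gap k k <= 1 / e.
  by rewrite mulrAC ler_pdivrMr// mul1r [leRHS]mulrC; apply: gap_diag_le.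
by lra.
Qed.

Lemma polytope_ratio_ge k n y : has_girth M k.+1 -> (0 < k)%N ->
  r [set: E]%SET = n -> in_polytope M y ->
  (1 - 1 / e + expR (- n%:R) / n%:R * gap n k) * \sum_i y i
    <= multilinear_ext rankR y.
Proof.
move=> Mk k0 rn; have kn : (k <= n)%N by rewrite -rn girth_le_rank.
move: y; apply: (ler_multilinear_tight (M := M)) => y T yP /eqP tT yT.
have yn : \sum_i y i = (r T)%:R by rewrite yT.
have [Tk|kT] := ltnP (r T) k.
  have cT : (#|T| <= k)%N.
    by rewrite leqNgt; apply/negP => /ltnW /(girth_rank_ge Mk); rewrite leqNgt Tk.
  apply: le_trans (multilinear_rank_small Mk yP cT).
  by rewrite yT tT ler_piMl// ratio_bound_le1.
apply: le_trans (multilinear_rank_ge Mk yP yn kT).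
have rT0 : (0 < r T)%N by apply: leq_trans kT.
have rTR : 0 < (r T)%:R :> R by rewrite ltr0n.
have rTn : (r T <= n)%N by rewrite -rn rank_mono// finset.subsetT.
rewrite yn mulrDl mulrC lerD2l.
apply: le_trans (ler_wpM2r (ltW rTR) (gap_ratio_le k rT0 rTn)) _.
by rewrite mulrAC divfK// gt_eqF.
Qed.

End CorrelationGap.

(** * Correlation gap of a matroid rank function *)

Theorem theorem1p5 (R : realType) (E : finType) (M : matroid E)
    (rho gamma : nat) (M_loopless : loopless M)
    (M_rank : rank M [set: E]%SET = rho) (M_girth : has_girth M gamma) :
  let e : R := expR 1 in
  let bound : R :=
    1 - 1 / e + expR (- rho%:R) / rho%:R *
      \sum_(0 <= i < gamma - 1)
        (gamma%:R - 1 - i%:R) *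
        ('C(rho, i)%:R * (e - 1) ^+ i - rho%:R ^+ i / (i`!)%:R) in
  [/\ bound <= correlation_gap (fun S : {set E} => (rank M S)%:R : R),
      1 - 1 / e <= bound
    & (2 < gamma)%N -> 1 - 1 / e < bound].
Proof.
move=> e bound; have g1 := loopless_girth_gt1 M_loopless M_girth.
case: gamma g1 M_girth @bound => [//|k] k0 M_girth bound.
have kn : (k <= rho)%N by rewrite -M_rank girth_le_rank.
have n0 : 0 < rho%:R :> R by rewrite ltr0n (leq_trans _ kn).
have boundE : bound = 1 - 1 / e + expR (- rho%:R) / rho%:R * gap rho k.
  rewrite /bound -gapE subSS subn0; congr (_ + _ * _).
  by apply: eq_bigr => i _; rewrite -natr1 addrK.
have c0 : 0 < expR (- rho%:R) / rho%:R :> R by rewrite divr_gt0 ?expR_gt0.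
have bound_ge : 1 - 1 / e <= bound.
  by rewrite boundE lerDl mulr_ge0 ?gap_ge0// ltW.
split=> //.
  apply: correlation_gap_rank_ge.
  - apply: lt_le_trans bound_ge; rewrite subr_gt0 ltr_pdivrMr ?expR_gt0// mul1r.
    by have := @e_gt2 R; rewrite -/e; lra.
  - by rewrite boundE ratio_bound_le1.
  - by move=> y yP; rewrite boundE polytope_ratio_ge.
move=> k2; rewrite boundE ltrDl mulr_gt0// gap_gt0//.
by rewrite -(ltr0n R).
Qed.
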